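(* Let $(A,\prec,\succ,\alpha)$ be a Hom-J-dendriform algebra. (a) The product $x\cdot y=x\succ y+y\prec x$ defines a Hom-pre-Jordan algebra $(A,\cdot,\alpha)$ (called the associated vertical Hom-pre-Jordan algebra). (b) The product $x\diamond y=x\succ y+x\prec y$ defines a Hom-pre-Jordan algebra $(A,\diamond,\alpha)$ (called the associated horizontal Hom-pre-Jordan algebra). (c) The associated vertical and horizontal Hom-pre-Jordan algebras $(A,\cdot,\alpha)$ and $(A,\diamond,\alpha)$ have the same associated Hom-Jordan algebra $(A,\circ,\alpha)$, given by $x\circ y=x\cdot y+y\cdot x=x\diamond y+y\diamond x$.
   Context: All vector spaces are over a field $\mathbb{K}$ of characteristic $0$. A Hom-algebra is a triple $(A,\mu,\alpha)$ with $A$ a vector space, $\mu$ a bilinear multiplication on $A$, and $\alpha:A\to A$ a linear map. A Hom-Jordan algebra is a Hom-algebra $(A,\circ,\alpha)$ such that, for all $x,y\in A$, $x\circ y=y\circ x$ and $as_\alpha(x\circ x,\alpha(y),\alpha(x))=0$, where $as_\alpha(a,b,c)=(a\circ b)\circ\alpha(c)-\alpha(a)\circ(b\circ c)$. A Hom-pre-Jordan algebra is a Hom-algebra $(A,\cdot,\alpha)$ such that, writing $x\circ y=x\cdot y+y\cdot x$, for all $x,y,z,u\in A$: $$[\alpha(x)\circ\alpha(y)]\cdot[\alpha(z)\cdot\alpha(u)]+[\alpha(y)\circ\alpha(z)]\cdot[\alpha(x)\cdot\alpha(u)]+[\alpha(z)\circ\alpha(x)]\cdot[\alpha(y)\cdot\alpha(u)]$$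 $$=\alpha^2(x)\cdot[(y\circ z)\cdot\alpha(u)]+\alpha^2(y)\cdot[(z\circ x)\cdot\alpha(u)]+\alpha^2(z)\cdot[(x\circ y)\cdot\alpha(u)],$$ and $$[(x\circ z)\circ\alpha(y)]\cdot\alpha^2(u)+\alpha^2(x)\cdot[\alpha(y)\cdot(z\cdot u)]+\alpha^2(z)\cdot[\alpha(y)\cdot(x\cdot u)]$$ $$=\alpha^2(x)\cdot[(y\circ z)\cdot\alpha(u)]+\alpha^2(y)\cdot[(z\circ x)\cdot\alpha(u)]+\alpha^2(z)\cdot[(x\circ y)\cdot\alpha(u)].$$ Its associated Hom-Jordan algebra is $(A,\circ,\alpha)$ with $x\circ y=x\cdot y+y\cdot x$. A Hom-J-dendriform algebra is a quadruple $(A,\prec,\succ,\alpha)$ with $A$ a vector space, $\alpha:A\to A$ linear and $\prec,\succ:A\otimes A\to A$ linear, such that, putting $x\cdot y=x\succ y+y\prec x$, $x\diamond y=x\succ y+x\prec y$, $x\circ y=x\cdot y+y\cdot x=x\diamond y+y\diamond x$, for all $x,y,z,u\in A$: (i) $\alpha(x\circ y)\succ\alpha(z\succ u)+\alpha(y\circ z)\succ\alpha(x\succ u)+\alpha(z\circ x)\succ\alpha(y\succ u)=\alpha^2(x)\succ[(y\circ z)\succ\alpha(u)]+\alpha^2(y)\succ[(z\circ x)\succ\alpha(u)]+\alpha^2(z)\succ[(x\circ y)\succ\alpha(u)]$; (ii) $\alpha(x\circ y)\succ\alpha(z\succ u)+\alpha(y\circ z)\succ\alpha(x\succ u)+\alpha(z\circ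 x)\succ\alpha(y\succ u)=\alpha^2(x)\succ[\alpha(y)\succ(z\succ u)]+\alpha^2(z)\succ[\alpha(y)\succ(x\succ u)]+[\alpha(y)\circ(z\circ x)]\succ\alpha^2(u)$; (iii) $\alpha(x\circ y)\succ\alpha(z\prec u)+\alpha(x\cdot z)\prec\alpha(y\diamond u)+\alpha(y\cdot z)\prec\alpha(x\diamond u)=\alpha^2(x)\succ[\alpha(z)\prec(y\diamond u)]+\alpha^2(y)\succ[\alpha(z)\prec(x\diamond u)]+[(x\circ y)\cdot\alpha(z)]\prec\alpha^2(u)$; (iv) $\alpha(z\cdot y)\prec\alpha(x\diamond u)+\alpha(x\cdot y)\prec\alpha(z\diamond u)+\alpha(x\circ z)\succ\alpha(y\prec u)=\alpha^2(x)\succ[(z\cdot y)\prec\alpha(u)]+\alpha^2(z)\succ[(x\cdot y)\prec\alpha(u)]+\alpha^2(y)\prec[(x\circ z)\diamond\alpha(u)]$; (v) $\alpha(x\circ y)\succ\alpha(z\prec u)+\alpha(x\cdot z)\prec\alpha(y\diamond u)+\alpha(y\cdot z)\prec\alpha(x\diamond u)=\alpha^2(x)\succ[\alpha(y)\succ(z\prec u)]+\alpha^2(z)\prec[\alpha(y)\diamond(x\diamond u)]+[\alpha(y)\cdot(x\cdot z)]\prec\alpha^2(u)$.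
   Formalization: The map α is additionally assumed multiplicative for both operations, α(x≺y)=α(x)≺α(y) and α(x≻y)=α(x)≻α(y); with α merely linear the statement is false. *)

(* Defs.v *)
From HB Require Import structures.
From mathcomp Require Import all_boot all_order all_algebra.

Set Implicit Arguments.
Unset Strict Implicit.
Unset Printing Implicit Defensive.

Import GRing.Theory.
Local Open Scope ring_scope.

Section HomAlgebras.

Variables (K : fieldType) (A : lmodType K).
Implicit Types (mu prec succ : A -> A -> A) (alpha : A -> A).

Definition hom_algebra mu alpha : Prop :=
  bilinear_for *:%R *:%R mu /\ linear alpha.

Definition hom_associator mu alpha (a b c : A) : A :=
  mu (mu a b) (alpha c) - mu (alpha a) (mu b c).

Definition hom_jordan mu alpha : Prop :=
  [/\ hom_algebra mu alpha,
      forall x y, mu x y = mu y x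
    & forall x y, hom_associator mu alpha (mu x x) (alpha y) (alpha x) = 0].

(* Jordan product, without the factor 1/2. *)
Definition anticomm mu (x y : A) : A := mu x y + mu y x.

Definition hom_pre_jordan mu alpha : Prop :=
  let al := alpha in
  let al2 := fun x => alpha (alpha x) in
  let circ := anticomm mu in
  [/\ hom_algebra mu alpha,
      forall x y z u,
        mu (circ (al x) (al y)) (mu (al z) (al u))
        + mu (circ (al y) (al z)) (mu (al x) (al u))
        + mu (circ (al z) (al x)) (mu (al y) (al u))
        = mu (al2 x) (mu (circ y z) (al u))
          + mu (al2 y) (mu (circ z x) (al u))
          + mu (al2 z) (mu (circ x y) (al u))
    & forall x y z u,
        mu (circ (circ x z) (al y)) (al2 u)
        + mu (al2 x) (mu (al y) (mu z u))
        + mu (al2 z) (mu (al y) (mu x u))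
        = mu (al2 x) (mu (circ y z) (al u))
          + mu (al2 y) (mu (circ z x) (al u))
          + mu (al2 z) (mu (circ x y) (al u))].

Definition vertical prec succ (x y : A) : A := succ x y + prec y x.

Definition horizontal prec succ (x y : A) : A := succ x y + prec x y.

(* alpha is only required to be linear.  These axioms contain alpha (x o y),
   where those of hom_pre_jordan contain alpha x o alpha y; the two agree when
   alpha is a morphism for prec and succ, and linearity alone does not suffice
   for the vertical and horizontal products to be Hom-pre-Jordan. *)
Definition hom_J_dendriform prec succ alpha : Prop :=
  let al := alpha in
  let al2 := fun x => alpha (alpha x) in
  let dot := vertical prec succ in
  let dia := horizontal prec succ in
  let circ := anticomm dot in
  [/\ [/\ bilinear_for *:%R *:%R prec, bilinear_for *:%R *:%R succ
        & linear alpha]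
    & [/\ forall x y z u,
            succ (al (circ x y)) (al (succ z u))
            + succ (al (circ y z)) (al (succ x u))
            + succ (al (circ z x)) (al (succ y u))
            = succ (al2 x) (succ (circ y z) (al u))
              + succ (al2 y) (succ (circ z x) (al u))
              + succ (al2 z) (succ (circ x y) (al u)),
          forall x y z u,
            succ (al (circ x y)) (al (succ z u))
            + succ (al (circ y z)) (al (succ x u))
            + succ (al (circ z x)) (al (succ y u))
            = succ (al2 x) (succ (al y) (succ z u))
              + succ (al2 z) (succ (al y) (succ x u))
              + succ (circ (al y) (circ z x)) (al2 u),
          forall x y z u,
            succ (al (circ x y)) (al (prec z u))
            + prec (al (dot x z)) (al (dia y u))
            + prec (al (dot y z)) (al (dia x u))
            = succ (al2 x) (prec (al z) (dia y u))
              + succ (al2 y) (prec (al z) (dia x u))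
              + prec (dot (circ x y) (al z)) (al2 u),
          forall x y z u,
            prec (al (dot z y)) (al (dia x u))
            + prec (al (dot x y)) (al (dia z u))
            + succ (al (circ x z)) (al (prec y u))
            = succ (al2 x) (prec (dot z y) (al u))
              + succ (al2 z) (prec (dot x y) (al u))
              + prec (al2 y) (dia (circ x z) (al u))
        & forall x y z u,
            succ (al (circ x y)) (al (prec z u))
            + prec (al (dot x z)) (al (dia y u))
            + prec (al (dot y z)) (al (dia x u))
            = succ (al2 x) (succ (al y) (prec z u))
              + prec (al2 z) (dia (al y) (dia x u))
              + prec (dot (al y) (dot x z)) (al2 u)]].

End HomAlgebras.

(* Main.v *)
Require Import Defs.
From mathcomp Require Import all_boot all_order all_algebra.

Set Implicit Arguments.
Unset Strict Implicit.
Unset Printing Implicit Defensive.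

Import GRing.Theory.
Local Open Scope ring_scope.

(** Write x.y, x<>y and x o y for the vertical, horizontal and symmetrized
    products of a Hom-J-dendriform algebra.

    Two observations organize the proof.  The first is a duality: replacing
    [prec] by its opposite exchanges the vertical and horizontal products, and
    it preserves the axioms ([hom_J_dendriform_op]).  Indeed o is unchanged, the
    common left-hand side of (iii), (iv) and (v) becomes itself once the
    variables are permuted, the right-hand sides of (iii) and (iv) are
    exchanged, and that of (v) is fixed.  Hence (a) is (b) for the opposite of
    [prec], and only the horizontal product has to be treated.

    The second is that in an iterated horizontal product a <> (b <> (.. <> u))
    the choices of [succ] or [prec] at each node separate the axioms: the part
    with [succ] everywhere is governed by (i) and (ii), and the parts where
    [prec] occurs are governed by (iii), (iv) and (v).  The first
    Hom-pre-Jordan identity is the sum of (i) and of the three instances of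
    (iv) in which x, y and z in turn play the role of the second variable.  The
    two Hom-pre-Jordan identities share a side, so in the second one that side
    may be replaced by the left-hand side of the first; it is then the sum of
    (ii), one instance of (iii) and two of (v) ([hom_pre_jordan_horizontal]).

    In (c), the two symmetrized products are sums of the same four terms.  That
    they are Hom-Jordan holds for every multiplicative Hom-pre-Jordan algebra
    in which 3 is invertible ([hom_jordan_anticomm]): the defect of the
    Hom-Jordan identity is a combination of the Hom-pre-Jordan identities at
    repeated arguments, where the first identity, taken at x = y = z, gives
    three times the relation that is needed. *)

(** * Sums in an abelian group *)

(* Moves the summand a of a right-associated sum to the front of the right-hand
   side of the goal. *)
Ltac bring_front a :=
  lazymatch goal with
  | |- _ = a => idtac
  | |- _ = a + _ => idtac
  | _ => first [rewrite [in RHS](addrCA _ a) | rewrite [in RHS](addrC _ a)];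
         bring_front a
  end.

(* Proves that two sums have the same summands, up to order and bracketing. *)
Ltac same_summands :=
  rewrite -?addrA;
  repeat (lazymatch goal with
          | |- ?a + _ = _ => bring_front a; apply: (congr1 (+%R a))
          end);
  reflexivity.

(** * Bilinear products *)

Section Bilinear.

Variables (K : fieldType) (A : lmodType K).
Implicit Types (mu nu : A -> A -> A).

Lemma bilinearDl {mu} : bilinear_for *:%R *:%R mu ->
  forall z, {morph mu^~ z : x y / x + y}.
Proof. by move=> [mul _] z x y; have := mul z 1 x y; rewrite /= !scale1r. Qed.

Lemma bilinearDr {mu} : bilinear_for *:%R *:%R mu ->
  forall z, {morph mu z : x y / x + y}.
Proof. by move=> [_ mur] z x y; have := mur z 1 x y; rewrite /= !scale1r. Qed.

Lemma linear_morphD (f : A -> A) : linear f -> {morph f : x y / x + y}.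
Proof. by move=> f_lin x y; have := f_lin 1 x y; rewrite !scale1r. Qed.

Lemma bilinear_op mu : bilinear_for *:%R *:%R mu ->
  bilinear_for *:%R *:%R (fun x y => mu y x).
Proof. by case=> mul mur; split=> z a x y; [exact: mur | exact: mul]. Qed.

Lemma bilinear_add mu nu :
  bilinear_for *:%R *:%R mu -> bilinear_for *:%R *:%R nu ->
  bilinear_for *:%R *:%R (fun x y => mu x y + nu x y).
Proof.
move=> [mul mur] [nul nur]; split=> z a x y /=.
  by have /= -> := mul z a x y; have /= -> := nul z a x y;
    rewrite scalerDr addrACA.
by have /= -> := mur z a x y; have /= -> := nur z a x y;
  rewrite scalerDr addrACA.
Qed.

Lemma anticommC mu x y : anticomm mu x y = anticomm mu y x.
Proof. exact: addrC. Qed.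

End Bilinear.

(** * From Hom-pre-Jordan to Hom-Jordan *)

Section PreJordan.

Variables (K : fieldType) (A : lmodType K).
Variables (mu : A -> A -> A) (alpha : A -> A).

(** Modulo the second Hom-pre-Jordan identity at (x, y, x, x), and the first one
    at (x, x, y, x), what remains of the Hom-Jordan identity is
    (alpha x o alpha x).(alpha x.alpha y) = alpha^2 x.((x o x).alpha y), which
    is a third of the first identity at (x, x, x, y). *)
Lemma hom_jordan_anticomm :
  3%:R != 0 :> K -> {morph alpha : x y / mu x y} ->
  hom_pre_jordan mu alpha -> hom_jordan (anticomm mu) alpha.
Proof.
move=> three_neq0 alphaM [[mu_bil alpha_lin] id1 id2].
have mulDr := bilinearDr mu_bil.
have alphaD := linear_morphD alpha_lin.
split; first by split=> //; apply: bilinear_add => //; apply: bilinear_op.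
  exact: anticommC.
move=> x y; rewrite /hom_associator; apply/eqP; rewrite subr_eq0; apply/eqP.
have cube : mu (anticomm mu (alpha x) (alpha x)) (mu (alpha x) (alpha y))
    = mu (alpha (alpha x)) (mu (anticomm mu x x) (alpha y)).
  apply: (scalerI three_neq0); rewrite !scaler_nat !mulrSr !mulr0n !add0r.
  exact: id1.
have id12 := etrans (id2 x y x x) (esym (id1 x y x x)).
have alphaC u v : alpha (anticomm mu u v) = anticomm mu (alpha u) (alpha v).
  by rewrite alphaD !alphaM.
rewrite alphaC (anticommC mu (alpha y)).
set P := anticomm mu (alpha x) (alpha x) in cube id12 *.
set Q := anticomm mu (anticomm mu x x) (alpha y) in id12 *.
rewrite {1}/anticomm [RHS]/anticomm.
have -> : mu (alpha (alpha x)) Q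
    = mu P (mu (alpha x) (alpha y))
    + (mu (alpha (alpha x)) (mu (alpha y) (mu x x))
      + mu (alpha (alpha x)) (mu (alpha y) (mu x x))).
  by rewrite cube -mulDr -mulDr -mulDr.
rewrite (anticommC mu (alpha y)) in id12.
rewrite addrCA [X in _ + X]addrA id12.
rewrite [mu P (anticomm _ _ _)]mulDr [mu (anticomm _ _ _) P]mulDr.
same_summands.
Qed.

End PreJordan.

(** * Hom-J-dendriform algebras *)

Section Dendriform.

Variables (K : fieldType) (A : lmodType K).
Implicit Types (prec succ : A -> A -> A) (alpha : A -> A).

Lemma anticomm_vertical_horizontal prec succ :
  anticomm (vertical prec succ) =2 anticomm (horizontal prec succ).
Proof. by move=> x y; rewrite /anticomm /vertical /horizontal; same_summands. Qed.

(** Axioms (i) and (ii) only involve [succ] and the product o, which is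
    self-dual.  Up to the names of the variables, (iii) for the dual structure is
    (iv) for the original one, (iv) is (iii), and (v) is (v). *)
Lemma hom_J_dendriform_op prec succ alpha :
  hom_J_dendriform prec succ alpha ->
  hom_J_dendriform (fun x y => prec y x) succ alpha.
Proof.
move=> [[prec_bil succ_bil alpha_lin] [ax1 ax2 ax3 ax4 ax5]].
have dotE : vertical (fun x y => prec y x) succ = horizontal prec succ by [].
have diaE : horizontal (fun x y => prec y x) succ = vertical prec succ by [].
have circE x y : anticomm (horizontal prec succ) x y
    = anticomm (vertical prec succ) x y.
  by rewrite anticomm_vertical_horizontal.
split; first by split=> //; apply: bilinear_op.
rewrite dotE diaE; split=> x y z u; rewrite !circE.
- exact: ax1.
- exact: ax2.
- by apply: etrans (etrans (ax4 x u y z) _); same_summands.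
- by apply: etrans (etrans (ax3 x z u y) _); same_summands.
- by apply: etrans (etrans (ax5 x y u z) _); same_summands.
Qed.

(** Both identities are obtained by adding instances of the axioms and expanding
    the horizontal products just enough for the summands to match. *)
Lemma hom_pre_jordan_horizontal prec succ alpha :
  {morph alpha : x y / prec x y} -> {morph alpha : x y / succ x y} ->
  hom_J_dendriform prec succ alpha ->
  hom_pre_jordan (horizontal prec succ) alpha.
Proof.
move=> alpha_prec alpha_succ.
move=> [[prec_bil succ_bil alpha_lin] [ax1 ax2 ax3 ax4 ax5]].
have succDr := bilinearDr succ_bil; have precDl := bilinearDl prec_bil.
have alphaD := linear_morphD alpha_lin.
set dot := vertical prec succ in ax1 ax2 ax3 ax4 ax5.
set dia := horizontal prec succ in ax3 ax4 ax5 *.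
set circ := anticomm dot in ax1 ax2 ax3 ax4 ax5.
have circC x y : circ x y = circ y x by exact: anticommC.
have dotDr : forall z, {morph dot z : x y / x + y}.
  exact: bilinearDr (bilinear_add succ_bil (bilinear_op prec_bil)).
have circE x y : anticomm dia x y = circ x y.
  by rewrite -anticomm_vertical_horizontal.
have alpha_dot x y : alpha (dot x y) = dot (alpha x) (alpha y).
  by rewrite alphaD alpha_succ alpha_prec.
have alpha_dia x y : alpha (dia x y) = dia (alpha x) (alpha y).
  by rewrite alphaD alpha_succ alpha_prec.
have alpha_circ x y : alpha (circ x y) = circ (alpha x) (alpha y).
  by rewrite alphaD !alpha_dot.
have alphaE := (alpha_circ, alpha_dot, alpha_dia, alpha_succ, alpha_prec).
have dia1 x y : dia x y = succ x y + prec x y by [].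
have dia2 x y z : dia x (dia y z)
    = succ x (succ y z) + succ x (prec y z) + prec x (dia y z).
  by rewrite -succDr.
have dia3 x y z t : dia x (dia y (dia z t))
    = succ x (succ y (succ z t)) + succ x (succ y (prec z t))
      + succ x (prec y (dia z t)) + prec x (dia y (dia z t)).
  by rewrite dia2 -!succDr.
have prec_circ x y z : prec (circ x y) z = prec (dot x y) z + prec (dot y x) z.
  exact: precDl.
have cyclic x y z u :
    dia (circ (alpha x) (alpha y)) (dia (alpha z) (alpha u))
    + dia (circ (alpha y) (alpha z)) (dia (alpha x) (alpha u))
    + dia (circ (alpha z) (alpha x)) (dia (alpha y) (alpha u))
    = dia (alpha (alpha x)) (dia (circ y z) (alpha u))
      + dia (alpha (alpha y)) (dia (circ z x) (alpha u))
      + dia (alpha (alpha z)) (dia (circ x y) (alpha u)).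
  (* The second variable of (iv) is the one left out of the product o. *)
  have eqs := congr2 +%R (ax1 x y z u) (congr2 +%R (ax4 z y x u)
                (congr2 +%R (ax4 x z y u) (ax4 y x z u))).
  rewrite !dia2 !prec_circ !succDr.
  rewrite !alphaE in eqs.
  by apply: etrans (etrans eqs _); same_summands.
split=> [|x y z u|x y z u]; rewrite ?circE //.
  split=> //; exact: bilinear_add.
(* The term [prec (circ (circ x z) (alpha y)) (alpha (alpha u))] splits into a
   part with alpha y on the right, found in (iii), and a part with alpha y on
   the left, found in the two instances of (v). *)
have eqs := congr2 +%R (ax2 x y z u) (congr2 +%R (ax3 z x y u)
              (congr2 +%R (ax5 x y z u) (ax5 z y x u))).
rewrite !alphaE [circ (alpha z) (alpha y)]circC in eqs.
rewrite -cyclic !dia3 ![in RHS]dia2 !prec_circ.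
rewrite (circC x z) [circ (circ z x) _]circC [dia (circ _ _) _]dia1.
rewrite prec_circ [dot (alpha y) (circ z x)]dotDr precDl.
by apply: etrans (etrans (esym eqs) _); same_summands.
Qed.

(** The vertical product is convertible to the horizontal product of the dual
    structure. *)
Lemma hom_pre_jordan_vertical prec succ alpha :
  {morph alpha : x y / prec x y} -> {morph alpha : x y / succ x y} ->
  hom_J_dendriform prec succ alpha ->
  hom_pre_jordan (vertical prec succ) alpha.
Proof.
move=> alpha_prec alpha_succ /hom_J_dendriform_op.
by apply: hom_pre_jordan_horizontal => // x y; apply: alpha_prec.
Qed.

End Dendriform.

Theorem proposition3p1 (K : fieldType) (char0 : has_pchar0 K)
    (A : lmodType K) (prec succ : A -> A -> A) (alpha : A -> A)
    (alpha_prec : {morph alpha : x y / prec x y})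
    (alpha_succ : {morph alpha : x y / succ x y})
    (JD : hom_J_dendriform prec succ alpha) :
  let dot := vertical prec succ in
  let dia := horizontal prec succ in
  [/\ hom_pre_jordan dot alpha,
      hom_pre_jordan dia alpha
    & [/\ hom_jordan (anticomm dot) alpha,
          hom_jordan (anticomm dia) alpha
        & anticomm dot =2 anticomm dia]].
Proof.
move=> dot dia.
have three_neq0 : 3%:R != 0 :> K by rewrite (pcharf0P K).1.
have dotJ : hom_pre_jordan dot alpha by exact: hom_pre_jordan_vertical.
have diaJ : hom_pre_jordan dia alpha by exact: hom_pre_jordan_horizontal.
have alphaD := let: conj (And3 _ _ alpha_lin) _ := JD in linear_morphD alpha_lin.
split=> //; split; last exact: anticomm_vertical_horizontal.
- by apply: hom_jordan_anticomm => // x y; rewrite alphaD alpha_succ alpha_prec.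
- by apply: hom_jordan_anticomm => // x y; rewrite alphaD alpha_succ alpha_prec.
Qed.
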